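(* Let $d\ge 1$. Every aperiodic linearly repetitive Delone set $X\subset\mathbb{R}^d$ is densely repetitive; that is, there exists a constant $C_{DR}(X)\in\mathbb{R}$ such that $M_X(T)\le C_{DR}(X)\, N_X(T)^{1/d}$ for all $T\ge 1$.
   Context: $B(p,s)$ denotes the closed Euclidean ball in $\mathbb{R}^d$ around $p$ with radius $s$. A set $X\subset\mathbb{R}^d$ is a Delone set if there exist $0<r(X),R(X)<\infty$ such that every ball in $\mathbb{R}^d$ with radius $r(X)$ meets $X$ in at most one point and every ball with radius $R(X)$ meets $X$ in at least one point. For $T>0$, a $T$-patch of $X$ centered at $x$ is a set $X\cap B(x,T)$ with $x\in X$. The number of $T$-patches up to translation is $N_X(T)=\sharp\{(X-x)\cap B(0,T): x\in X\}$, where $\sharp$ denotes cardinality and $X-x=\{z-x: z\in X\}$. $X$ is repetitive if for every $T>0$ there is a finite $M$ such that every closed ball of radius $M$ in $\mathbb{R}^d$ contains the center of a translate of every possible $T$-patch of $X$ (i.e. for every $x\in X$ and $p\in\mathbb{R}^d$ there is $y\in X\cap B(p,M)$ with $(X-y)\cap B(0,T)=(X-x)\cap B(0,T)$). The smallest such $M$ is denoted $M_X(T)$. $X$ is linearly repetitive if it is repetitive and there is a constant $C_{LR}(X)\in\mathbb{R}$ with $M_X(T)\le C_{LR}(X)\,T$ for every $T\ge 1$. $X$ is densely repetitive if it is repetitive and there is a constant $C_{DR}(X)\in\mathbb{R}$ with $M_X(T)\le C_{DR}(X)\,N_X(T)^{1/d}$ for every $T\ge 1$. $X$ is non-periodic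 if there is no $t\in\mathbb{R}^d\setminus\{0\}$ with $X+t=X$; it is aperiodic if every element of its hull is non-periodic. The hull is the closure of the set of translates $\{X+t: t\in\mathbb{R}^d\}$ in the natural (local) topology, in which $X_n\to Y$ iff for all $\rho,\varepsilon>0$ and all sufficiently large $n$ one has $X_n\cap B(0,\rho)\subset Y+B(0,\varepsilon)$ and $Y\cap B(0,\rho)\subset X_n+B(0,\varepsilon)$. For repetitive Delone sets, non-periodicity and aperiodicity are equivalent. *)

(* Defs.v *)
From mathcomp Require Import all_boot all_order all_algebra finmap.
From mathcomp Require Import all_classical all_reals all_analysis.
Set Implicit Arguments.
Unset Strict Implicit.
Unset Printing Implicit Defensive.
Import Order.TTheory GRing.Theory Num.Theory.
Local Open Scope classical_set_scope.
Local Open Scope ring_scope.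

(* MathComp-Analysis equips 'rV[R]_d with the sup norm `|x|, hence an explicit
   Euclidean norm. *)
Definition enorm (R : realType) (d : nat) (x : 'rV[R]_d) : R :=
  Num.sqrt (\sum_(i < d) x ord0 i ^+ 2).

Definition eball (R : realType) (d : nat) (p : 'rV[R]_d) (s : R)
    : set 'rV[R]_d :=
  [set x | enorm (x - p) <= s].

Definition translate (R : realType) (d : nat) (X : set 'rV[R]_d) (t : 'rV[R]_d)
    : set 'rV[R]_d :=
  [set x + t | x in X].

Definition delone (R : realType) (d : nat) (X : set 'rV[R]_d) : Prop :=
  exists r s : R,
    [/\ 0 < r, 0 < s,
        forall p : 'rV[R]_d, is_subset1 (X `&` eball p r) &
        forall p : 'rV[R]_d, X `&` eball p s !=set0].

(* The T-patch of X centered at x, translated so that x becomes the origin. *)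
Definition Tpatch (R : realType) (d : nat) (X : set 'rV[R]_d) (T : R)
    (x : 'rV[R]_d) : set 'rV[R]_d :=
  translate X (- x) `&` eball 0 T.

(* N_X(T).  For infinite A, fset_set A is the empty set; this case does not
   occur for repetitive Delone sets: by repetitivity every T-patch is already
   centered at one of the finitely many points of X in some fixed ball. *)
Definition num_patches (R : realType) (d : nat) (X : set 'rV[R]_d) (T : R)
    : nat :=
  #|` fset_set [set Tpatch X T x | x in X]|.

(* The real numbers M such that every closed ball of radius M contains the
   center of a translate of every T-patch of X.  If X is nonempty they are
   nonnegative, since eball p M is empty for M < 0. *)
Definition repetitivity_radii (R : realType) (d : nat) (X : set 'rV[R]_d) (T : R)
    : set R :=
  [set M | forall x p : 'rV[R]_d, X x ->
     exists y, (X `&` eball p M) y /\ Tpatch X T y = Tpatch X T x].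

Definition repetitive (R : realType) (d : nat) (X : set 'rV[R]_d) : Prop :=
  forall T : R, 0 < T -> repetitivity_radii X T !=set0.

(* M_X(T).  When X is Delone and the set of radii is nonempty, the infimum is
   attained, because balls are closed and X is locally finite. *)
Definition repetitivity_radius (R : realType) (d : nat) (X : set 'rV[R]_d)
    (T : R) : R :=
  inf (repetitivity_radii X T).

Definition linearly_repetitive (R : realType) (d : nat) (X : set 'rV[R]_d)
    : Prop :=
  repetitive X /\
  exists C : R, forall T : R, 1 <= T -> repetitivity_radius X T <= C * T.

Definition densely_repetitive (R : realType) (d : nat) (X : set 'rV[R]_d)
    : Prop :=
  repetitive X /\
  exists C : R, forall T : R, 1 <= T ->
    repetitivity_radius X T <= C * (num_patches X T)%:R `^ (d%:R^-1).

Definition local_cvg (R : realType) (d : nat) (Xn : nat -> set 'rV[R]_d)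
    (Y : set 'rV[R]_d) : Prop :=
  forall rho eps : R, 0 < rho -> 0 < eps ->
  \forall n \near \oo,
    Xn n `&` eball 0 rho `<=` [set y + b | y in Y & b in eball 0 eps] /\
    Y `&` eball 0 rho `<=` [set x + b | x in Xn n & b in eball 0 eps].

(* The local topology is metrizable on closed sets, so the closure of the set
   of translates consists of the limits of sequences of translates.  If X is
   Delone, all such limits are Delone. *)
Definition hull (R : realType) (d : nat) (X : set 'rV[R]_d)
    : set (set 'rV[R]_d) :=
  [set Y | exists t : nat -> 'rV[R]_d, local_cvg (fun n => translate X (t n)) Y].

Definition non_periodic (R : realType) (d : nat) (X : set 'rV[R]_d) : Prop :=
  ~ exists2 t : 'rV[R]_d, t != 0 & translate X t = X.

Definition aperiodic (R : realType) (d : nat) (X : set 'rV[R]_d) : Prop :=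
  forall Y : set 'rV[R]_d, hull X Y -> non_periodic Y.

(* Main.v *)
(** If two points x <> y of X at distance small compared with T have the same
    T-patch, then X is locally invariant under t = y - x on a large ball around
    x.  By linear repetitivity this ball contains a copy of every |t|-patch, so
    X + t = X.  Hence aperiodicity forces points with equal T-patches to be at
    distance at least c T, the T-patches of the points in a ball of radius
    comparable to T are pairwise distinct, and N_X(T) is at least of order
    T^d. *)
Require Import Defs.
From mathcomp Require Import all_boot all_order all_algebra.
From mathcomp Require Import all_classical all_reals all_analysis.
From mathcomp Require Import finmap ring lra.
Set Implicit Arguments.
Unset Strict Implicit.
Unset Printing Implicit Defensive.
Import Order.TTheory GRing.Theory Num.Theory.
Local Open Scope classical_set_scope.
Local Open Scope ring_scope.

(** * Comparison of the Euclidean norm with coordinates *)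

Lemma coord_le_enorm (R : realType) (d : nat) (x : 'rV[R]_d) i :
  `|x ord0 i| <= enorm x.
Proof.
rewrite -sqrtr_sqr; apply: ler_wsqrtr.
by rewrite (bigD1 i) //= lerDl; apply: sumr_ge0 => j _; exact: sqr_ge0.
Qed.

(** The sum of squares is at most [d * b ^+ 2], and [d <= d ^ 2] for naturals. Using [d] instead of
    its square root only worsens constants. *)
Lemma enorm_le_coord (R : realType) (d : nat) (x : 'rV[R]_d) (b : R) :
  0 <= b -> (forall i, `|x ord0 i| <= b) -> enorm x <= d%:R * b.
Proof.
move=> b0 xb.
have db0 : 0 <= d%:R * b by rewrite mulr_ge0.
rewrite -[leRHS]ger0_norm // -sqrtr_sqr; apply: ler_wsqrtr.
apply: (@le_trans _ _ (\sum_(i < d) b ^+ 2)).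
  by apply: ler_sum => i _; rewrite -real_normK ?num_real // lerXn2r ?nnegrE.
rewrite sumr_const card_ord -[leLHS]mulr_natl exprMn; apply: ler_wpM2r; first exact: sqr_ge0.
case: d {x xb db0} => [|d]; first by rewrite expr0n.
by rewrite -natrX ler_nat; exact: leq_pmulr.
Qed.

Lemma enorm_ge0 (R : realType) (d : nat) (x : 'rV[R]_d) : 0 <= enorm x.
Proof. exact: sqrtr_ge0. Qed.

Lemma enorm0 (R : realType) (d : nat) : enorm (0 : 'rV[R]_d) = 0.
Proof.
by rewrite /enorm big1 ?sqrtr0 // => i _; rewrite mxE expr0n.
Qed.

(* The factor d is the price for bypassing the Cauchy-Schwarz inequality. *)
Lemma enormB_le (R : realType) (d : nat) (x y : 'rV[R]_d) :
  enorm (x - y) <= d%:R * (enorm x + enorm y).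
Proof.
apply: enorm_le_coord => [|i]; first by rewrite addr_ge0 ?enorm_ge0.
by rewrite !mxE (le_trans (ler_normB _ _)) // lerD ?coord_le_enorm.
Qed.

(** * Equal patches and global periods *)

Lemma mem_translate (R : realType) (d : nat) (X : set 'rV[R]_d)
    (t z : 'rV[R]_d) : translate X t z <-> X (z - t).
Proof.
split=> [[x Xx <-]|Xz]; first by rewrite addrK.
by exists (z - t) => //; rewrite subrK.
Qed.

Lemma mem_Tpatch (R : realType) (d : nat) (X : set 'rV[R]_d) (T : R)
    (x z : 'rV[R]_d) : Tpatch X T x z <-> X (z + x) /\ enorm z <= T.
Proof.
rewrite /Tpatch /eball /setI /= subr0; split=> [[/mem_translate]|[Xz zT]].
  by rewrite opprK.
by split=> //; apply/mem_translate; rewrite opprK.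
Qed.

(** Since [S] bounds the norm of [t = y - x], the [S]-patch of a point decides whether its shifts by
    [t] and [- t] lie in [X]. So invariance under [t] need only be checked at points within [M] of
    [x], where the two [T]-patches can be compared. *)
Lemma eq_Tpatch_period (R : realType) (d : nat) (X : set 'rV[R]_d)
    (S T M : R) (x y : 'rV[R]_d) :
  (1 <= d)%N -> X x -> repetitivity_radii X S M ->
  enorm (y - x) <= S -> d%:R * (M + enorm (y - x)) <= T ->
  Tpatch X T x = Tpatch X T y -> translate X (y - x) = X.
Proof.
move=> d1 Xx XM; set t := y - x => tS MT xy.
(* Every point w of X has a copy w' near x with the same neighbours w' +- t. *)
have copy w : X w -> exists w', [/\ X w', enorm (w' - x) <= M &
    Tpatch X S w' = Tpatch X S w].
  by move=> Xw; have [w' [[? ?] ?]] := XM w x Xw; exists w'.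
have neighbour w w' u : Tpatch X S w' = Tpatch X S w -> enorm u <= S ->
    X (u + w') -> X (u + w).
  move=> ww' uS Xu; have /mem_Tpatch[]// : Tpatch X S w u.
  by rewrite -ww'; apply/mem_Tpatch.
have enormNt : enorm (- t) = enorm t.
  by congr Num.sqrt; apply: eq_bigr => i _; rewrite mxE sqrrN.
have d1R : 1 <= d%:R :> R by rewrite ler1n.
apply/seteqP; split=> w.
  (* Here [w'] copies [w - t]. Seen from [x] it is [w' - x]; the same vector seen from [y] is the
     point [w' + t]. *)
  move=> /mem_translate /[dup] Xwt /copy[w' [Xw' w'x ww']].
  have -> : w = t + (w - t) by rewrite addrC subrK.
  apply: neighbour ww' tS _.
  have /mem_Tpatch[] : Tpatch X T y (w' - x).
    rewrite -xy; apply/mem_Tpatch; rewrite subrK; split=> //.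
    have := enorm_ge0 t; have := enorm_ge0 (w' - x); nra.
  by have -> : t + w' = w' - x + y by rewrite addrC /t [y - x]addrC addrA.
(* Conversely, [w'] seen from [y] is [w' - x - t], and this vector seen from [x] is [w' - t]. Its
   norm is why [T] must dominate [d%:R * (M + enorm t)]. *)
move=> /copy[w' [Xw' w'x ww']]; apply/mem_translate.
rewrite addrC; apply: neighbour ww' _ _; first by rewrite enormNt.
have /mem_Tpatch[] : Tpatch X T x (w' - x - t).
  rewrite xy; apply/mem_Tpatch; split.
    by rewrite /t opprB addrA !subrK.
  apply: le_trans MT; apply: le_trans (enormB_le _ _) _.
  by rewrite ler_wpM2l // lerD2r.
by rewrite addrAC subrK addrC.
Qed.

(** [X] lies in its own hull, as the limit of the constant sequence of zero translates. *)
Lemma aperiodic_non_periodic (R : realType) (d : nat) (X : set 'rV[R]_d) :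
  aperiodic X -> non_periodic X.
Proof.
apply; exists (fun=> 0) => rho eps rho0 eps0.
have -> : translate X 0 = X.
  by apply/seteqP; split=> z; rewrite mem_translate subr0.
apply: nearW => n; split=> z [Xz _]; exists z => //; exists 0; rewrite ?addr0 //;
  by rewrite /eball /= subrr enorm0 ltW.
Qed.

(** * Linear repetitivity and repulsion of equal patches *)

(** [repetitivity_radius] is an infimum. Enlarging the constant to [|C| + 1] makes the bound strict,
    so an actual radius [M] lies below it, whether or not the infimum is attained. *)
Lemma linearly_repetitive_radii (R : realType) (d : nat) (X : set 'rV[R]_d) :
  linearly_repetitive X -> exists K : R, 0 < K /\
    forall T, 1 <= T ->
      repetitivity_radius X T <= K * T /\
      exists2 M, repetitivity_radii X T M & M <= K * T.
Proof.
move=> [repX [C XC]]; exists (`|C| + 1); split=> [|T T1].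
  by rewrite ltr_wpDl.
have T0 : 0 < T by lra.
have lt_radius : repetitivity_radius X T < (`|C| + 1) * T.
  have := XC T T1; have := ler_norm C; nra.
split; first exact: ltW.
have [M XM /ltW MT] := inf_lt (repX T T0) lt_radius.
by exists M.
Qed.

Lemma repulsion (R : realType) (d : nat) (X : set 'rV[R]_d) :
  (1 <= d)%N -> delone X -> non_periodic X -> linearly_repetitive X ->
  exists2 c : R, 0 < c & forall T x y, X x -> X y ->
    enorm (y - x) <= c * T -> Tpatch X T x = Tpatch X T y -> x = y.
Proof.
move=> d1 [r [s [r0 _ sepX _]]] npX /linearly_repetitive_radii[K [K0 XK]].
(* Distinct points are more than [r] apart, so [S = q * enorm (y - x)] is at least 1, as linear
   repetitivity requires, and at least [enorm (y - x)]. Then [M <= K * S], and the hypothesis on [T]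
   in [eq_Tpatch_period] dictates the constant below. *)
pose q := r^-1 + 1.
have rV0 : 0 < r^-1 by rewrite invr_gt0.
have q0 : 0 < q by rewrite /q; lra.
have d0R : 0 < d%:R :> R by rewrite ltr0n.
have c0 : 0 < d%:R * (K * q + 1) by rewrite mulr_gt0 // addr_gt0 // mulr_gt0.
exists (d%:R * (K * q + 1))^-1; first by rewrite invr_gt0.
move=> T x y Xx Xy; rewrite ler_pdivlMl // => xyT patch_xy.
apply/eqP; rewrite eq_sym -subr_eq0; apply/negP => /negP yx0.
apply: npX; exists (y - x) => //.
have ryx : r < enorm (y - x).
  rewrite ltNge; apply: contra_neqN yx0 => yxr.
  rewrite (sepX x y x) ?subrr //; split=> //.
  by rewrite /eball /= subrr enorm0 ltW.
have q1 : 1 <= q * enorm (y - x).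
  have : r^-1 * r = 1 by rewrite mulVf ?gt_eqF.
  rewrite /q; nra.
have [_ [M XM MK]] := XK _ q1.
apply: eq_Tpatch_period XM _ _ patch_xy => //.
  by rewrite /q; have := enorm_ge0 (y - x); nra.
apply: le_trans xyT; rewrite -mulrA ler_wpM2l //.
by rewrite mulrDl mul1r -mulrA lerD2r.
Qed.

(** * Finiteness and lower bounds for the number of patches *)

(** Cut space into cubes of side [e = r / d]. Two points of [X] in one cube are at distance at most
    [d * e = r], hence equal, so the cube index [f] is injective on the ball, with finitely many
    values. *)
Lemma finite_setI_eball (R : realType) (d : nat) (X : set 'rV[R]_d)
    (M : R) : (1 <= d)%N -> delone X -> finite_set (X `&` eball 0 M).
Proof.
move=> d1 [r [s [r0 _ sepX _]]].
have d0R : 0 < d%:R :> R by rewrite ltr0n.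
pose e := r / d%:R; have e0 : 0 < e by rewrite divr_gt0.
pose h (x : 'rV[R]_d) i := (x ord0 i + M) / e.
pose n := Num.truncn ((M + M) / e).
pose f (x : 'rV[R]_d) : {ffun 'I_d -> 'I_n.+1} :=
  [ffun i => inord (Num.truncn (h x i))].
have hM x i : eball 0 M x -> 0 <= h x i <= (M + M) / e.
  rewrite /eball /= subr0 => xM; have := coord_le_enorm x i.
  rewrite ler_norml => /andP[x1 x2].
  apply/andP; split; first by rewrite divr_ge0 // ?(ltW e0) //; lra.
  by rewrite ler_pM2r ?invr_gt0 //; lra.
rewrite -(eq_finite_set (inj_card_eq (f := f) _)); first exact: finite_finset.
move=> x y /set_mem[Xx xM] /set_mem[Xy yM] /ffunP fxy.
apply: (sepX x); split=> //; rewrite /eball /=; first by rewrite subrr enorm0 ltW.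
have -> : r = d%:R * e by rewrite mulrC divfK ?gt_eqF.
apply: enorm_le_coord => [|i]; first exact: ltW.
have /andP[hx0 hxM] := hM x i xM; have /andP[hy0 hyM] := hM y i yM.
(* [inord] loses nothing here: on the ball every index is at most [n]. *)
have txy : Num.truncn (h x i) = Num.truncn (h y i).
  have := congr1 val (fxy i); rewrite !ffunE /= !inordK // ltnS; exact: le_truncn.
have /andP[x1 x2] := truncn_itv hx0; have /andP[y1 y2] := truncn_itv hy0.
move: y1 y2; rewrite -txy => y1 y2.
have -> : (y - x) ord0 i = (h y i - h x i) * e.
  rewrite !mxE /h -mulrBl divfK ?gt_eqF //; ring.
rewrite normrM (gtr0_norm e0); apply: ler_piMl; first exact: ltW.
apply: ltW; rewrite ltr_norml.
move: x2 y2; rewrite -natr1; lra.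
Qed.

(** Every patch already occurs at a center in one fixed ball. This makes [num_patches] a genuine
    count rather than the default value 0. *)
Lemma finite_patches (R : realType) (d : nat) (X : set 'rV[R]_d) (T : R) :
  (1 <= d)%N -> delone X -> repetitive X -> 0 < T ->
  finite_set [set Tpatch X T x | x in X].
Proof.
move=> d1 delX repX /repX[M XM].
apply: sub_finite_set (finite_image (Tpatch X T) (finite_setI_eball M d1 delX)).
by move=> _ [x Xx <-]; have [y [? ?]] := XM x 0 Xx; exists y.
Qed.

(* One point of X in each of the disjoint balls of radius s around the points
   of the grid 3s{0,...,m-1}^d. *)
Lemma delone_grid (R : realType) (d : nat) (X : set 'rV[R]_d) (s : R) (m : nat) :
  0 < s -> (forall p, X `&` eball p s !=set0) ->
  exists f : {ffun 'I_d -> 'I_m} -> 'rV[R]_d,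
    [/\ injective f, forall k, X (f k) &
        forall k l, enorm (f k - f l) <= d%:R * (3 * s * m%:R)].
Proof.
move=> s0 Xs; pose p (k : {ffun 'I_d -> 'I_m}) : 'rV[R]_d :=
  \row_i (3 * s * (k i)%:R).
have [f Xf] := choice (fun k => Xs (p k)).
have fp k i : - s <= f k ord0 i - 3 * s * (k i)%:R <= s.
  have [_] := Xf k; rewrite /eball /= => /(le_trans (coord_le_enorm _ i)).
  by rewrite !mxE ler_norml.
have step (a b : nat) : (a < b)%N -> 3 * s * (a%:R + 1) <= 3 * s * b%:R.
  by move=> ab; rewrite natr1 ler_pM2l ?ler_nat //; lra.
(* The spacing [3 * s] exceeds the length [2 * s] of the windows around grid coordinates, so [z]
   cannot lie in two different windows. *)
have near_le (z : R) (a b : nat) :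
    - s <= z - 3 * s * a%:R <= s -> - s <= z - 3 * s * b%:R <= s -> (a <= b)%N.
  move=> /andP[a1 a2] /andP[b1 b2]; rewrite leqNgt; apply/negP => /step.
  rewrite mulrDr mulr1 => ba; lra.
exists f; split=> [k l fkl|k|k l].
- apply/ffunP => i; apply: ord_inj; apply/eqP; rewrite eqn_leq.
  have fk := fp k i; have fl := fp l i; rewrite fkl in fk.
  by rewrite (near_le _ _ _ fk fl) (near_le _ _ _ fl fk).
- by case: (Xf k).
(* Grid coordinates differ by at most [3 * s * (m - 1)], and the two displacements add at most
   [2 * s]. *)
- apply: enorm_le_coord => [|i]; first by rewrite !mulr_ge0 // ltW.
  have /andP[l1 l2] := fp l i; have /andP[k1 k2] := fp k i.
  have km := step _ _ (ltn_ord (k i)); have lm := step _ _ (ltn_ord (l i)).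
  have pos (a : nat) : 0 <= 3 * s * a%:R by rewrite !mulr_ge0 // ltW.
  have k0 := pos (k i); have l0 := pos (l i).
  rewrite mulrDr mulr1 in km; rewrite mulrDr mulr1 in lm.
  by rewrite !mxE ler_norml; apply/andP; split; lra.
Qed.

Lemma leq_card_fset_set (T : finType) (U : choiceType) (A : set U)
    (f : T -> U) :
  finite_set A -> injective f -> (forall k, A (f k)) ->
  (#|T| <= #|` fset_set A|)%N.
Proof.
move=> finA f_inj Af; rewrite cardE -(size_map f); apply: uniq_leq_size.
  by rewrite map_inj_uniq ?enum_uniq.
by move=> _ /mapP[k _ ->]; rewrite in_fset_set // mem_set.
Qed.

Lemma num_patches_gt0 (R : realType) (d : nat) (X : set 'rV[R]_d) (T : R) :
  finite_set [set Tpatch X T x | x in X] -> X !=set0 ->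
  (0 < num_patches X T)%N.
Proof.
move=> finX [x Xx]; rewrite -card_unit.
by apply: (leq_card_fset_set (f := fun=> Tpatch X T x)) => [//|[] []//|_]; exists x.
Qed.

(** The [m ^ d] points chosen near the grid lie pairwise within [c * T], so repulsion gives them
    pairwise distinct patches. *)
Lemma num_patches_ge (R : realType) (d : nat) (X : set 'rV[R]_d) (c s T : R)
    (m : nat) :
  finite_set [set Tpatch X T x | x in X] ->
  0 < s -> (forall p, X `&` eball p s !=set0) ->
  (forall x y, X x -> X y -> enorm (y - x) <= c * T ->
    Tpatch X T x = Tpatch X T y -> x = y) ->
  d%:R * (3 * s * m%:R) <= c * T -> (m ^ d <= num_patches X T)%N.
Proof.
move=> finX s0 Xs repul mT; have [f [f_inj Xf fd]] := delone_grid m s0 Xs.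
rewrite -{1}(card_ord m) -{1}(card_ord d) -card_ffun.
apply: (leq_card_fset_set (f := Tpatch X T \o f)) => [//|k l|k]; last by exists (f k).
move=> /repul kl; apply/f_inj/kl => //; exact: le_trans (fd _ _) mT.
Qed.

Theorem mainTheorem1 (R : realType) (d : nat) (d_ge1 : (1 <= d)%N)
    (X : set 'rV[R]_d) :
  delone X -> aperiodic X -> linearly_repetitive X -> densely_repetitive X.
Proof.
move=> delX /aperiodic_non_periodic npX lrX.
have repX : repetitive X by case: lrX.
have [c c0 repul] := repulsion d_ge1 delX npX lrX.
have [K [K0 XK]] := linearly_repetitive_radii lrX.
have [_ [s [_ s0 _ Xs]]] := delX.
have d0R : 0 < d%:R :> R by rewrite ltr0n.
(* [b * m] is the bound from [delone_grid] on distances between chosen points; [m] will be the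
   largest natural number with [b * m <= c * T]. *)
pose b := d%:R * (3 * s); have b0 : 0 < b by rewrite !mulr_gt0.
split=> //; exists (K * (2 * (b / c))) => T T1.
have finX : finite_set [set Tpatch X T x | x in X].
  by apply: finite_patches => //; lra.
have root_le (m : nat) : (m ^ d <= num_patches X T)%N ->
    m%:R <= (num_patches X T)%:R `^ d%:R^-1 :> R.
  move=> mN.
  have <- : (m%:R `^ d%:R) `^ d%:R^-1 = m%:R :> R.
    by rewrite -powRrM mulfV ?lt0r_neq0 ?powRr1.
  apply: ge0_ler_powR; rewrite ?nnegrE ?invr_ge0 ?powR_ge0 //.
  by rewrite powR_mulrn // -natrX ler_nat.
(* For small [T] the number [m] may be 0, so [N >= 1] is needed separately to absorb the
   rounding. *)
have N1 := root_le 1%N; rewrite exp1n in N1.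
have {}N1 := N1 (num_patches_gt0 finX _).
pose m := Num.truncn (c * T / b).
have cT0 : 0 <= c * T / b by rewrite !mulr_ge0 ?invr_ge0 //; lra.
have /andP[m1 m2] := truncn_itv cT0.
have Nm : m%:R <= (num_patches X T)%:R `^ d%:R^-1 :> R.
  apply: root_le; apply: num_patches_ge finX s0 Xs (repul T) _.
  by rewrite mulrA mulrC -ler_pdivlMr.
have {}N1 : 1 <= (num_patches X T)%:R `^ d%:R^-1 :> R.
  by apply: N1; have [x [Xx _]] := Xs 0; exists x.
(* [c * T / b < m + 1], and both [m] and 1 are at most the [d]-th root of the number of patches;
   hence the factor 2. *)
have TN : T <= 2 * (b / c) * (num_patches X T)%:R `^ d%:R^-1.
  have {1}-> : T = c * T / b * (b / c) by field; rewrite !lt0r_neq0.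
  rewrite [leRHS]mulrAC ler_pM2r ?divr_gt0 //; apply: le_trans (ltW m2) _.
  by rewrite -natr1; lra.
have [+ _] := XK T T1; move=> /le_trans; apply.
by rewrite -mulrA ler_pM2l.
Qed.
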